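(* Being weakly uniserial is a Morita invariant property of modules: if $R$ and $S$ are rings and $F: {\rm Mod}_R\to {\rm Mod}_S$ is an equivalence between the categories of right $R$-modules and right $S$-modules, then for every weakly uniserial right $R$-module $M$ the right $S$-module $F(M)$ is weakly uniserial.
   Context: Rings are associative with identity and modules are unitary right modules; the equivalence $F$ is a (additive) category equivalence with an inverse equivalence $G:{\rm Mod}_S\to{\rm Mod}_R$. A module $M$ is called weakly uniserial if for any two submodules $N$ and $K$ of $M$ there exists an injective module homomorphism $N\to K$ or an injective module homomorphism $K\to N$. *)

(* Defs.v *)
From HB Require Import structures.
From mathcomp Require Import all_boot all_algebra.
From mathcomp Require Import boolp.

Set Implicit Arguments.
Unset Strict Implicit.
Unset Printing Implicit Defensive.

Import GRing.Theory.
Local Open Scope ring_scope.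

(* A right R-module is a left module over the converse ring R^c; v * a is
   written a *: v.  [pzRingType] does not exclude the zero ring. *)
Notation rmodType R := (lmodType R^c).

(* The subtype of elements of a submodule N, as a module in its own right.
   [submodClosed M] is the type of boolean predicates on M containing 0 and
   stable under addition and scaling; under the axioms of [boolp] every
   Prop-valued predicate is of this form. *)
Definition submodule (R : pzRingType) (M : rmodType R) (N : submodClosed M)
  : Type := {v : M | v \in N}.

HB.instance Definition _ (R : pzRingType) (M : rmodType R)
  (N : submodClosed M) := SubChoice.on (submodule N).
HB.instance Definition _ (R : pzRingType) (M : rmodType R)
  (N : submodClosed M) := [SubChoice_isSubLmodule of submodule N by <:].

Definition weakly_uniserial (R : pzRingType) (M : rmodType R) : Prop :=
  forall N K : submodClosed M,
    (exists f : {linear submodule N -> submodule K}, injective f) \/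
    (exists f : {linear submodule K -> submodule N}, injective f).

(* The morphisms of Mod_R are the R-linear maps; their equality is stated below
   as pointwise equality, which agrees with Leibniz equality.  In particular a
   functor needs no separate congruence law. *)
Lemma linear_eqP (R : pzRingType) (M N : lmodType R) (f g : {linear M -> N}) :
  f = g <-> f =1 g.
Proof.
split=> [-> //|]; case: f g => [f cf] [g cg] /= /funext efg.
rewrite {}efg in cf *; congr GRing.Linear.Pack.
case: cf cg => [[a] [b]] [[a'] [b']].
by rewrite (Prop_irrelevance a a') (Prop_irrelevance b b').
Qed.

Record mod_functor (R S : pzRingType) : Type := ModFunctor {
  fobj :> rmodType R -> rmodType S;
  fmap : forall M N : rmodType R,
    {linear M -> N} -> {linear fobj M -> fobj N};
  fmap_id : forall M : rmodType R, fmap (@idfun M) =1 idfun;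
  fmap_comp : forall (M N P : rmodType R)
    (g : {linear N -> P}) (f : {linear M -> N}),
    fmap (g \o f) =1 fmap g \o fmap f }.

Arguments fmap {R S} F {M N} f : rename.

Definition mod_functor_id (R : pzRingType) : mod_functor R R :=
  @ModFunctor R R id (fun M N f => f) (fun M => frefl _)
    (fun M N P g f => frefl _).

Lemma mod_functor_comp_id (R S T : pzRingType)
    (G : mod_functor S T) (F : mod_functor R S) (M : rmodType R) :
  fmap G (fmap F (@idfun M)) =1 idfun.
Proof.
have -> : fmap F (@idfun M) = @idfun (F M) :> {linear F M -> F M}.
  exact/linear_eqP/fmap_id.
exact: fmap_id.
Qed.

Lemma mod_functor_comp_comp (R S T : pzRingType)
    (G : mod_functor S T) (F : mod_functor R S) (M N P : rmodType R)
    (g : {linear N -> P}) (f : {linear M -> N}) :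
  fmap G (fmap F (g \o f)) =1 fmap G (fmap F g) \o fmap G (fmap F f).
Proof.
have -> : fmap F (g \o f) = (fmap F g \o fmap F f) :> {linear F M -> F P}.
  exact/linear_eqP/fmap_comp.
exact: fmap_comp.
Qed.

Definition mod_functor_comp (R S T : pzRingType)
    (G : mod_functor S T) (F : mod_functor R S) : mod_functor R T :=
  @ModFunctor R T (fun M => G (F M)) (fun M N f => fmap G (fmap F f))
    (@mod_functor_comp_id R S T G F) (@mod_functor_comp_comp R S T G F).

Definition additive_functor (R S : pzRingType) (F : mod_functor R S) : Prop :=
  forall (M N : rmodType R) (f g : {linear M -> N}),
    fmap F (f \+ g) =1 fmap F f \+ fmap F g.

Definition naturally_isomorphic (R S : pzRingType) (F G : mod_functor R S)
  : Prop :=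
  exists (eta : forall M : rmodType R, {linear F M -> G M})
         (theta : forall M : rmodType R, {linear G M -> F M}),
    (forall M : rmodType R, cancel (eta M) (theta M)
                            /\ cancel (theta M) (eta M)) /\
    (forall (M N : rmodType R) (f : {linear M -> N}),
      eta N \o fmap F f =1 fmap G f \o eta M).

Definition mod_equivalence (R S : pzRingType) (F : mod_functor R S) : Prop :=
  exists G : mod_functor S R,
    naturally_isomorphic (mod_functor_comp G F) (mod_functor_id R) /\
    naturally_isomorphic (mod_functor_comp F G) (mod_functor_id S).

(* Main.v *)
(** The image under a quasi-inverse G of the inclusion of a submodule N of F M
    is again injective, so up to isomorphism G N is a submodule of M.  Weak
    uniseriality of M compares G N with G K by an injection, and F carries that
    injection back to one between N and K. *)

Require Import Defs.
From HB Require Import structures.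
From mathcomp Require Import all_boot all_algebra.
From mathcomp Require Import boolp.

Set Implicit Arguments.
Unset Strict Implicit.
Unset Printing Implicit Defensive.

Import GRing.Theory.
Local Open Scope ring_scope.

(** Encodes [v] as the map out of the regular right module with value [v] at 1, so that a functor
    can act on it. *)
Definition scale_by (R : pzRingType) (M : rmodType R) (v : M) :
  (R^c)^o -> M := fun a => (a : R^c) *: v.

Lemma scale_by_is_linear (R : pzRingType) (M : rmodType R) (v : M) :
  linear (scale_by v).
Proof. by move=> a b c; rewrite /scale_by scalerDl -scalerA. Qed.

HB.instance Definition _ (R : pzRingType) (M : rmodType R) (v : M) :=
  GRing.isLinear.Build R^c (R^c)^o M *:%R (scale_by v) (scale_by_is_linear v).

(** Naturality expresses [f \o eta M] through [fmap G (fmap F f)], and [eta M] is onto, so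
    [fmap F f] determines [f]. *)
Lemma fmap_faithful (R S : pzRingType) (F : mod_functor R S)
    (G : mod_functor S R)
    (GF : naturally_isomorphic (mod_functor_comp G F) (mod_functor_id R))
    (M N : rmodType R) (f g : {linear M -> N}) :
  fmap F f =1 fmap F g -> f =1 g.
Proof.
move=> /linear_eqP fg x; have [eta [theta [etaK nat_eta]]] := GF.
rewrite -((etaK M).2 x).
have := nat_eta _ _ f (theta M x); have := nat_eta _ _ g (theta M x).
by rewrite /= fg => -> <-.
Qed.

(* Elements of F M are maps from the regular module, so injectivity is left
   cancellability, which G transports back to f. *)
Lemma fmap_inj (R S : pzRingType) (F : mod_functor R S)
    (Feqv : mod_equivalence F) (M N : rmodType R) (f : {linear M -> N}) :
  injective f -> injective (fmap F f).
Proof.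
move=> finj u v fuv; have [G [GF FG]] := Feqv.
pose a (w : F M) : {linear (S^c)^o -> F M} := scale_by w.
suff /(_ 1) : a u =1 a v by rewrite /= /scale_by !scale1r.
apply: (fmap_faithful FG) => x.
have [eta [theta [etaK nat_eta]]] := GF.
(* Once [f \o eta M] is applied to both sides, naturality trades it for
   [eta N \o fmap G (fmap F f)], which can be composed with [fmap G (a u)]. *)
apply: (can_inj (etaK M).1); apply: finj.
have := nat_eta _ _ f (fmap G (a u) x); have := nat_eta _ _ f (fmap G (a v) x).
rewrite /= => <- <-.
(* Both maps send 1 to the common value of [fmap F f] at [u] and [v]. Leibniz equality allows
   rewriting under [fmap G]. *)
have fa : (fmap F f \o a u) = (fmap F f \o a v) :> {linear (S^c)^o -> F N}.
  by apply/linear_eqP => s; rewrite /= /scale_by !linearZ fuv.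
have Gcomp := fun a => @fmap_comp _ _ G _ _ _ (fmap F f) a x.
have := Gcomp (a u); have := Gcomp (a v).
by rewrite fa /= => -> ->.
Qed.

Definition linear_range (R : pzRingType) (A M : rmodType R)
    (i : {linear A -> M}) : {pred M} := fun v => `[< exists x, i x = v >].

Lemma linear_range_closed (R : pzRingType) (A M : rmodType R)
    (i : {linear A -> M}) : submod_closed (linear_range i).
Proof.
split; first by apply/asboolP; exists 0; rewrite linear0.
move=> a u v /asboolP[x <-] /asboolP[y <-].
by apply/asboolP; exists (a *: x + y); rewrite linearP.
Qed.

HB.instance Definition _ (R : pzRingType) (A M : rmodType R)
    (i : {linear A -> M}) :=
  GRing.isSubmodClosed.Build R^c M (linear_range i) (linear_range_closed i).

(** Weak uniseriality compares genuine submodules only; this trades an embedded module for its image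
    and back. *)
Lemma submodule_iso_range (R : pzRingType) (A M : rmodType R)
    (i : {linear A -> M}) : injective i ->
  exists (f : {linear A -> submodule (linear_range i)})
         (g : {linear submodule (linear_range i) -> A}),
    injective f /\ injective g.
Proof.
move=> iinj.
have ri x : i x \in linear_range i by apply/asboolP; exists x.
pose f x : submodule (linear_range i) := Sub (i x) (ri x).
have flin : linear f.
  by move=> a x y; apply: val_inj; rewrite /= linearP.
(* A chosen preimage; injectivity of [i] makes it unique, hence linear in [v]. *)
pose g (v : submodule (linear_range i)) : A :=
  projT1 (cid (asboolW (valP v))).
have gE v : i (g v) = val v by rewrite /g; case: cid.
have glin : linear g.
  by move=> a u v; apply: iinj; rewrite linearP !gE.
pose fL := GRing.isLinear.Build _ _ _ _ f flin.
pose gL := GRing.isLinear.Build _ _ _ _ g glin.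
pose f' : {linear A -> submodule (linear_range i)} := HB.pack f fL.
pose g' : {linear submodule (linear_range i) -> A} := HB.pack g gL.
exists f', g'; split=> [x y /(congr1 val) /= /iinj // | u v /= guv].
by apply: val_inj; rewrite -!gE; congr (i _).
Qed.

Lemma weakly_uniserial_inj (R : pzRingType) (M A B : rmodType R)
    (i : {linear A -> M}) (j : {linear B -> M}) :
  weakly_uniserial M -> injective i -> injective j ->
  (exists f : {linear A -> B}, injective f) \/
  (exists f : {linear B -> A}, injective f).
Proof.
move=> hM /submodule_iso_range[a [a' [ainj a'inj]]].
move=> /submodule_iso_range[b [b' [binj b'inj]]].
have [[f finj]|[f finj]] := hM (linear_range i) (linear_range j).
  by left; exists (b' \o (f \o a)); do 2![apply: inj_comp => //].
by right; exists (a' \o (f \o b)); do 2![apply: inj_comp => //].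
Qed.

Theorem proposition2p7 (R S : pzRingType) (F : mod_functor R S)
    (Fadd : additive_functor F) (Feqv : mod_equivalence F)
    (M : rmodType R) (hM : weakly_uniserial M) :
  weakly_uniserial (F M).
Proof.
have [G [GF FG]] := Feqv.
have Geqv : mod_equivalence G by exists F.
have [eta [theta [etaK _]]] := GF; have [e [t [eK _]]] := FG.
pose i (N : submodClosed (F M)) : {linear submodule N -> F M} := val.
(* [G] keeps the inclusion injective, and [eta M] identifies [G (F M)] with [M]. *)
have iinj N : injective (eta M \o fmap G (i N)).
  by apply: inj_comp (can_inj (etaK M).1) (fmap_inj Geqv _); apply: val_inj.
(* Conjugating [fmap F f] by the isomorphisms [t A] and [e B] removes [F (G _)] from both ends. *)
have back (A B : rmodType S) (f : {linear G A -> G B}) : injective f ->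
    exists g : {linear A -> B}, injective g.
  move=> finj; exists (e B \o (fmap F f \o t A)).
  apply: inj_comp (can_inj (eK B).1) (inj_comp (fmap_inj Feqv finj) _).
  exact: can_inj (eK A).2.
move=> N K; have [[f finj]|[f finj]] := weakly_uniserial_inj hM (iinj N) (iinj K).
  by left; apply: back finj.
by right; apply: back finj.
Qed.
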